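(* The nonautonomous $n$-dimensional coupled NLS system $$i\psi_t=-a(t)\Delta\psi+b(t)|\boldsymbol{x}|^2\psi+\lambda a(t)\beta^2(t)\mu^s(t)(|\varphi|^{2s}+|\psi|^{2s})\psi,$$ $$i\varphi_t=-a(t)\Delta\varphi+b(t)|\boldsymbol{x}|^2\varphi+\lambda a(t)\beta^2(t)\mu^s(t)(|\varphi|^{2s}+|\psi|^{2s})\varphi,$$ with $t\in\mathbb{R}$ and $\boldsymbol{x}\in\mathbb{R}^n$, can be transformed into the standard coupled NLS system $$iu_\tau=\Delta_{\boldsymbol{\xi}}u-\lambda(|v|^{2s}+|u|^{2s})u,\qquad iv_\tau=\Delta_{\boldsymbol{\xi}}v-\lambda(|v|^{2s}+|u|^{2s})v,$$ by the transformations $$\psi(\boldsymbol{x},t)=\frac{1}{\sqrt{\mu(t)}}\,e^{i\sum_{j=1}^n\left(\alpha(t)x_j^2+\delta_j(t)x_j+\kappa_j(t)\right)}u(\boldsymbol{\xi},\tau),\qquad \varphi(\boldsymbol{x},t)=\frac{1}{\sqrt{\mu(t)}}\,e^{i\sum_{j=1}^n\left(\alpha(t)x_j^2+\delta_j(t)x_j+\kappa_j(t)\right)}v(\boldsymbol{\xi},\tau),$$ with $\xi_j=\beta(t)x_j+\varepsilon_j(t)$ for $j=1,2,\dots,n$ and $\tau=\gamma(t)$. Additionally, the following Riccati system is satisfied: $$\alpha'+b+4a\alpha^2=0,\quad \beta'+4a\alpha\beta=0,\quad \gamma'+a\beta^2=0,$$ $$\delta_j'+4a\alpha\delta_j=0,\quad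 \varepsilon_j'+2a\beta\delta_j=0,\quad \kappa_j'+a\delta_j^2=0,\qquad j=1,\dots,n.$$ Considering the substitution $$\alpha=\frac{\mu'}{4na\mu},$$ it follows that the Riccati equation $\alpha'+b+4a\alpha^2=0$ becomes $$\mu''-\frac{a'}{a}\mu'+4nab\,\mu+\left(\frac{1-n}{n}\right)\frac{(\mu')^2}{\mu}=0.$$
   Context: $a,b$ are time-dependent coefficients, $\lambda\in\mathbb{R}$ and $s>0$ are constants; $\alpha,\beta,\gamma,\delta_j,\varepsilon_j,\kappa_j,\mu$ are functions of $t$, with $\mu$ linked to $\alpha$ by the stated substitution. $\Delta$ is the Laplacian in $\boldsymbol{x}=(x_1,\dots,x_n)$, $\Delta_{\boldsymbol{\xi}}$ the Laplacian in $\boldsymbol{\xi}=(\xi_1,\dots,\xi_n)$, $i$ is the imaginary unit, and primes denote $d/dt$. *)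

(* Defs.v *)
From HB Require Import structures.
From mathcomp Require Import all_boot all_order all_algebra.
From mathcomp Require Import all_classical all_reals all_analysis.
From mathcomp Require Import complex.

Set Implicit Arguments.
Unset Strict Implicit.
Unset Printing Implicit Defensive.

Import Order.TTheory GRing.Theory Num.Theory.
Import numFieldNormedType.Exports.

Local Open Scope ring_scope.
Local Open Scope classical_set_scope.
Local Open Scope complex_scope.

(* R[i] has no normed R-module structure in the library, so complex-valued
   functions of real variables are differentiated componentwise. *)
Section ComplexValued.
Variables (R : realType) (V : normedModType R).
Implicit Types (f : V -> R[i]) (x v : V).

Definition cderive f v x : R[i] :=
  'D_v (fun y => complex.Re (f y)) x +i* 'D_v (fun y => complex.Im (f y)) x.

Definition cderivable f x v : Prop :=
  derivable (fun y => complex.Re (f y)) x v /\ derivable (fun y => complex.Im (f y)) x v.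

Definition cdifferentiable f x : Prop :=
  differentiable (fun y => complex.Re (f y)) x /\ differentiable (fun y => complex.Im (f y)) x.

End ComplexValued.

Definition expi (R : realType) (theta : R) : R[i] := cos theta +i* sin theta.

(* R^n is modelled by row vectors, with coordinates x 0 j. *)
Section Fields.
Variables (R : realType) (n : nat).
Implicit Types (f : 'rV[R]_n -> R -> R[i]) (x : 'rV[R]_n) (t : R).

Definition basis_vec (j : 'I_n) : 'rV[R]_n := delta_mx 0 j.

Definition dtime f x t : R[i] := cderive (f x) 1 t.

Definition laplacian (g : 'rV[R]_n -> R[i]) x : R[i] :=
  \sum_(j < n) cderive (cderive g (basis_vec j)) (basis_vec j) x.

(* The library norm on 'rV[R]_n is the sup norm; |x|^2 here is Euclidean. *)
Definition sqnorm x : R := \sum_(j < n) (x 0 j) ^+ 2.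

(* Regularity of a classical solution on R^n x J: jointly (Frechet)
   differentiable in (x, t), with second pure space derivatives. *)
Definition classical (J : set R) f : Prop :=
  forall x t, J t ->
    cdifferentiable (fun p : 'rV[R]_n * R => f p.1 p.2) (x, t) /\
    forall j, cderivable (cderive (f^~ t) (basis_vec j)) x (basis_vec j).

Definition coupling (s : R) (z w : R[i]) : R :=
  Normc.normc z `^ (2 * s) + Normc.normc w `^ (2 * s).

Definition nonautonomous_cnls (a b beta mu : R -> R) (lambda s : R)
    (J : set R) (psi phi : 'rV[R]_n -> R -> R[i]) : Prop :=
  [/\ classical J psi,
      classical J phi,
      forall x t, J t ->
        'i%C * dtime psi x t =
          - (a t)%:C * laplacian (psi^~ t) x
          + (b t * sqnorm x)%:C * psi x t
          + (lambda * a t * beta t ^+ 2 * mu t `^ s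
             * coupling s (phi x t) (psi x t))%:C * psi x t
    & forall x t, J t ->
        'i%C * dtime phi x t =
          - (a t)%:C * laplacian (phi^~ t) x
          + (b t * sqnorm x)%:C * phi x t
          + (lambda * a t * beta t ^+ 2 * mu t `^ s
             * coupling s (phi x t) (psi x t))%:C * phi x t].

Definition standard_cnls (lambda s : R) (J : set R)
    (u v : 'rV[R]_n -> R -> R[i]) : Prop :=
  [/\ classical J u,
      classical J v,
      forall xi tau, J tau ->
        'i%C * dtime u xi tau =
          laplacian (u^~ tau) xi
          - (lambda * coupling s (v xi tau) (u xi tau))%:C * u xi tau
    & forall xi tau, J tau ->
        'i%C * dtime v xi tau =
          laplacian (v^~ tau) xi
          - (lambda * coupling s (v xi tau) (u xi tau))%:C * v xi tau].

Definition transform (alpha beta gamma mu : R -> R)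
    (delta eps kappa : 'I_n -> R -> R) (w : 'rV[R]_n -> R -> R[i]) x t : R[i] :=
  ((Num.sqrt (mu t))^-1)%:C
  * expi (\sum_(j < n)
            (alpha t * (x 0 j) ^+ 2 + delta j t * x 0 j + kappa j t))
  * w (\row_(j < n) (beta t * x 0 j + eps j t)) (gamma t).

Definition riccati_eq (a b alpha : R -> R) t : Prop :=
  derive1 alpha t + b t + 4 * a t * alpha t ^+ 2 = 0.

Definition riccati_system (a b alpha beta gamma : R -> R)
    (delta eps kappa : 'I_n -> R -> R) (J : set R) : Prop :=
  forall t, J t ->
  [/\ derivable alpha t 1 /\ riccati_eq a b alpha t,
      derivable beta t 1 /\ derive1 beta t + 4 * a t * alpha t * beta t = 0,
      derivable gamma t 1 /\ derive1 gamma t + a t * beta t ^+ 2 = 0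
    & forall j,
      [/\ derivable (delta j) t 1 /\
            derive1 (delta j) t + 4 * a t * alpha t * delta j t = 0,
          derivable (eps j) t 1 /\
            derive1 (eps j) t + 2 * a t * beta t * delta j t = 0
        & derivable (kappa j) t 1 /\
            derive1 (kappa j) t + a t * delta j t ^+ 2 = 0]].

End Fields.

(* Main.v *)
Require Import Defs.
From HB Require Import structures.
From mathcomp Require Import all_boot all_order all_algebra.
From mathcomp Require Import all_classical all_reals all_analysis.
From mathcomp Require Import complex ring.

Set Implicit Arguments.
Unset Strict Implicit.
Unset Printing Implicit Defensive.

Import Order.TTheory GRing.Theory Num.Theory.
Import numFieldNormedType.Exports.

Local Open Scope ring_scope.
Local Open Scope classical_set_scope.

(* In polar form the ansatz is psi = mu^(-1/2) e^(iS) u(xi, tau) with S quadratic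
   in x, xi affine in x, and tau depending on t only. Substituting it, each
   coefficient of u, of the first derivatives of u and of the powers of x_j in
   the resulting equation vanishes by one equation of the Riccati system, the
   remaining i mu' / (2 mu) u being absorbed by alpha = mu' / (4 n a mu).

   Conversely, where beta does not vanish, gamma' = - a beta^2 has no zero, so
   gamma is injective on the interval J, and inverting the ansatz gives an ansatz
   of the same shape: mu is replaced by 1 / mu, beta by 1 / beta, alpha by
   - alpha / beta^2, and so on, composed with the inverse of gamma. Its coefficients
   solve the Riccati system with source and target equations exchanged, so both
   directions are instances of one computation, for a transformation between two
   Schroedinger equations with a general dispersion and a general harmonic
   potential. *)

(** * Directional derivatives of real-valued functions *)

Section RealDerivative.
Variables (R : realType) (V : normedModType R).
Implicit Types (f g : V -> R) (x v : V).

Lemma is_derive_add x v f g a b : is_derive x v f a -> is_derive x v g b ->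
  is_derive x v (fun y => f y + g y) (a + b).
Proof. exact: is_deriveD. Qed.

Lemma is_derive_sub x v f g a b : is_derive x v f a -> is_derive x v g b ->
  is_derive x v (fun y => f y - g y) (a - b).
Proof. exact: is_deriveB. Qed.

Lemma is_derive_mul x v f g a b : is_derive x v f a -> is_derive x v g b ->
  is_derive x v (fun y => f y * g y) (a * g x + f x * b).
Proof.
move=> fa gb; have fgab := is_deriveM fa gb.
by apply: (is_derive_eq fgab); rewrite addrC [a * _]mulrC.
Qed.

Lemma is_derive_bigsum n (h : 'I_n -> V -> R) x v (dh : 'I_n -> R) :
  (forall i, is_derive x v (h i) (dh i)) ->
  is_derive x v (fun y => \sum_(i < n) h i y) (\sum_(i < n) dh i).
Proof.
move=> H; rewrite (_ : (fun y => _) = \sum_(i < n) h i); first exact: is_derive_sum.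
by apply/funext => y; rewrite fct_sumE.
Qed.

(** The difference quotients on both sides are the same function of the increment. Rules along a
    direction [v] thereby reduce to rules in one real variable at 0. *)
Lemma is_derive1P x v (f : V -> R) l :
  is_derive x v f l <-> is_derive (0 : R) (1 : R) (fun h : R => f (h *: v + x)) l.
Proof.
have E : 'D_v f x = 'D_(1 : R) (fun h : R => f (h *: v + x)) (0 : R).
  rewrite /derive; set d := (fun h => _); set d' := (fun h => _).
  suff -> : d = d' by [].
  by apply/funext => h; rewrite /d /d' /= addr0 scale0r add0r [_%:A]mulr1.
split=> -[fx <-]; first by rewrite E; split=> //; exact: (derivable1P f x v).1.
by rewrite -E; split=> //; exact: (derivable1P f x v).2.
Qed.

Lemma is_derive_comp1 x v (f : R -> R) (g : V -> R) a b :
  is_derive (g x) 1 f a -> is_derive x v g b -> is_derive x v (f \o g) (a * b).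
Proof.
move=> fa /is_derive1P gb; apply/is_derive1P.
by apply: is_derive1_comp gb; rewrite scale0r add0r.
Qed.

Lemma is_derive_inv x v f df : f x != 0 -> is_derive x v f df ->
  is_derive x v (fun y => (f y)^-1) (- (f x) ^- 2 * df).
Proof.
move=> fx0 fdf; apply: (is_derive_comp1 (f := GRing.inv) _ fdf).
have := @is_deriveV R id (f x) 1 1 fx0 (is_derive_id _ _).
by rewrite [_ *: _]mulr1.
Qed.

End RealDerivative.

(* Only derivability along the line is needed, so that this also applies to
   second derivatives. *)
Lemma is_derive_line (R : realType) (V U : normedModType R) (g : U -> R) (A : V -> U)
    x v u (c l : R) :
  (forall h : R, A (h *: v + x) = (h * c) *: u + A x) ->
  is_derive (A x) u g l -> is_derive x v (g \o A) (c * l).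
Proof.
move=> AE /is_derive1P gl; apply/is_derive1P.
rewrite (_ : (fun h => _) = (fun k => g (k *: u + A x)) \o (fun h => h * c)).
  rewrite mulrC; apply: is_derive1_comp; first by rewrite mul0r.
  have := is_derive_mul (is_derive_id (0 : R) (1 : R)) (is_derive_cst c (0 : R) (1 : R)).
  by rewrite mul1r mulr0 addr0.
by apply/funext => h /=; rewrite AE.
Qed.


(** * Componentwise derivatives of complex-valued functions *)

Section ComplexDerivative.
Variables (R : realType) (V : normedModType R).
Implicit Types (f g : V -> R[i]) (x v : V).

(** Existence and value are kept in a single relation, so that derivation rules compose without
    separate derivability side conditions. *)
Definition is_cderive x v f (l : R[i]) : Prop :=
  is_derive x v (fun y => complex.Re (f y)) (complex.Re l) /\
  is_derive x v (fun y => complex.Im (f y)) (complex.Im l).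

Lemma is_cderive_val x v f l : is_cderive x v f l -> cderive f v x = l.
Proof. by rewrite /cderive => -[[_ ->] [_ ->]]; case: l. Qed.

Lemma is_cderive_ex x v f l : is_cderive x v f l -> cderivable f x v.
Proof. by move=> [[? _] [? _]]. Qed.

Lemma cderivableP x v f : cderivable f x v -> is_cderive x v f (cderive f v x).
Proof. by move=> [? ?]; split; apply: derivableP. Qed.

Lemma is_cderive_eq x v f l l' : is_cderive x v f l -> l = l' -> is_cderive x v f l'.
Proof. by move=> ? <-. Qed.

Lemma complex_ReM (z w : R[i]) : complex.Re (z * w) =
  complex.Re z * complex.Re w - complex.Im z * complex.Im w.
Proof. by case: z w => [? ?] []. Qed.

Lemma complex_ImM (z w : R[i]) : complex.Im (z * w) =
  complex.Re z * complex.Im w + complex.Im z * complex.Re w.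
Proof. by case: z w => [? ?] []. Qed.

Lemma complex_ReD (z w : R[i]) : complex.Re (z + w) = complex.Re z + complex.Re w.
Proof. by case: z w => [? ?] []. Qed.

Lemma complex_ImD (z w : R[i]) : complex.Im (z + w) = complex.Im z + complex.Im w.
Proof. by case: z w => [? ?] []. Qed.

Lemma is_cderiveM x v f g df dg :
  is_cderive x v f df -> is_cderive x v g dg ->
  is_cderive x v (fun y => f y * g y) (df * g x + f x * dg).
Proof.
move=> [fR fI] [gR gI]; split.
- under eq_fun do rewrite complex_ReM.
  rewrite complex_ReD !complex_ReM.
  apply: (is_derive_eq (is_derive_sub (is_derive_mul fR gR) (is_derive_mul fI gI))).
  by rewrite /=; ring.
- under eq_fun do rewrite complex_ImM.
  rewrite complex_ImD !complex_ImM.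
  apply: (is_derive_eq (is_derive_add (is_derive_mul fR gI) (is_derive_mul fI gR))).
  by rewrite /=; ring.
Qed.

Lemma is_cderiveD x v f g df dg :
  is_cderive x v f df -> is_cderive x v g dg ->
  is_cderive x v (fun y => f y + g y) (df + dg).
Proof.
move=> [fR fI] [gR gI]; split.
- by under eq_fun do rewrite complex_ReD; rewrite complex_ReD; exact: is_deriveD.
- by under eq_fun do rewrite complex_ImD; rewrite complex_ImD; exact: is_deriveD.
Qed.

Lemma is_cderive_real x v (f : V -> R) df :
  is_derive x v f df -> is_cderive x v (fun y => (f y)%:C%C) df%:C%C.
Proof. by move=> ?; split => //=; exact: is_derive_cst. Qed.

Lemma is_cderive_cst x v (c : R[i]) : is_cderive x v (fun=> c) 0.
Proof. by split; exact: is_derive_cst. Qed.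

Lemma is_cderive_expi x v (f : V -> R) df :
  is_derive x v f df ->
  is_cderive x v (fun y => expi (f y)) ('i%C * df%:C%C * expi (f x)).
Proof.
move=> fdf; split.
- apply: is_derive_eq; first exact: (is_derive_comp1 (is_derive_cos _) fdf).
  by rewrite /expi /=; ring.
- apply: is_derive_eq; first exact: (is_derive_comp1 (is_derive_sin _) fdf).
  by rewrite /expi /=; ring.
Qed.

End ComplexDerivative.

(** * Joint (Frechet) differentiability of the building blocks of the ansatz *)

Section Differentiability.
Variables (R : realType) (V : normedModType R).

Lemma differentiable_fst (U W : normedModType R) (p : U * W) :
  differentiable (fst : U * W -> U) p.
Proof. by apply: (@linear_differentiable _ _ _ fst) => ?; exact: cvg_fst. Qed.

Lemma differentiable_snd (U W : normedModType R) (p : U * W) :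
  differentiable (snd : U * W -> W) p.
Proof. by apply: (@linear_differentiable _ _ _ snd) => ?; exact: cvg_snd. Qed.

Lemma differentiable_bigsum (W : normedModType R) n (h : 'I_n -> V -> W) x :
  (forall i, differentiable (h i) x) ->
  differentiable (fun y => \sum_(i < n) h i y) x.
Proof.
move=> H; rewrite (_ : (fun y => _) = \sum_(i < n) h i); first exact: differentiable_sum.
by apply/funext => y; rewrite fct_sumE.
Qed.

Lemma differentiable_mul (f g : V -> R) x :
  differentiable f x -> differentiable g x -> differentiable (fun y => f y * g y) x.
Proof. exact: differentiableM. Qed.

Lemma differentiable_add (f g : V -> R) x :
  differentiable f x -> differentiable g x -> differentiable (fun y => f y + g y) x.
Proof. exact: differentiableD. Qed.

Lemma differentiable_row n (h : 'I_n -> V -> R) x :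
  (forall i, differentiable (h i) x) ->
  differentiable (fun y => \row_(i < n) h i y) x.
Proof.
move=> H.
rewrite (_ : (fun y => _) = (fun y => \sum_(i < n) h i y *: delta_mx 0 i)).
  by apply: differentiable_bigsum => i; exact: differentiableZl.
apply/funext => y; rewrite [LHS]row_sum_delta.
by apply: eq_bigr => i _; rewrite mxE.
Qed.

Lemma cdifferentiableM (f g : V -> R[i]) x :
  cdifferentiable f x -> cdifferentiable g x ->
  cdifferentiable (fun y => f y * g y) x.
Proof.
move=> [fR fI] [gR gI]; split=> /=.
- under eq_fun do rewrite complex_ReM.
  exact: differentiableB (differentiable_mul fR gR) (differentiable_mul fI gI).
- under eq_fun do rewrite complex_ImM.
  exact: differentiable_add (differentiable_mul fR gI) (differentiable_mul fI gR).
Qed.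

Lemma cdifferentiable_real (f : V -> R) x :
  differentiable f x -> cdifferentiable (fun y => (f y)%:C%C) x.
Proof. by move=> ?; split => //=; exact: differentiable_cst. Qed.

Lemma cdifferentiable_expi (f : V -> R) x :
  differentiable f x -> cdifferentiable (fun y => expi (f y)) x.
Proof.
move=> fx; split; apply: differentiable_comp => //; apply/derivable1_diffP.
- exact: derivable_cos.
- exact: derivable_sin.
Qed.

Lemma cdifferentiable_comp (U : normedModType R) (f : V -> U) (g : U -> R[i]) x :
  differentiable f x -> cdifferentiable g (f x) -> cdifferentiable (fun y => g (f y)) x.
Proof.
move=> fx [gR gI].
by split; [exact: (differentiable_comp fx gR)|exact: (differentiable_comp fx gI)].
Qed.

End Differentiability.

(** * Chain rule along a curve in space-time *)

Section JointChainRule.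
Variables (R : realType) (n : nat).
Implicit Types (xi : R -> 'rV[R]_n) (gamma : R -> R).

Lemma diff_fst_line (f : 'rV[R]_n * R -> R) y tau (v : 'rV[R]_n) :
  differentiable f (y, tau) ->
  is_derive y v (fun z => f (z, tau)) ('d f (y, tau) (v, 0)).
Proof.
move=> df; apply/is_derive1P.
have : is_derive (y, tau) (v, 0 : R) f ('d f (y, tau) (v, 0)).
  by rewrite -deriveE //; apply: derivableP; exact: diff_derivable.
move=> /is_derive1P; congr (is_derive _ _ _ _).
by apply/funext => h /=; congr (f (_, _)); rewrite /= scaler0 add0r.
Qed.

Lemma diff_snd_line (f : 'rV[R]_n * R -> R) y tau :
  differentiable f (y, tau) ->
  is_derive tau (1 : R) (fun r => f (y, r)) ('d f (y, tau) (0, 1)).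
Proof.
move=> df; apply/is_derive1P.
have : is_derive (y, tau) (0 : 'rV[R]_n, 1 : R) f ('d f (y, tau) (0, 1)).
  by rewrite -deriveE //; apply: derivableP; exact: diff_derivable.
move=> /is_derive1P; congr (is_derive _ _ _ _).
by apply/funext => h /=; congr (f (_, _)); rewrite /= scaler0 add0r.
Qed.

(** The derivative is the differential of [f] applied to the velocity of the curve, which linearity
    expands into partial derivatives. Joint differentiability is what makes partial derivatives
    suffice. *)
Lemma is_derive_curve (f : 'rV[R]_n * R -> R) xi gamma t dxi dgamma :
  differentiable f (xi t, gamma t) ->
  (forall j, is_derive t (1 : R) (fun r => xi r 0 j) (dxi j)) ->
  is_derive t (1 : R) gamma dgamma ->
  is_derive t (1 : R) (fun r => f (xi r, gamma r))
    (\sum_(j < n) dxi j * 'D_(basis_vec R j) (fun y => f (y, gamma t)) (xi t)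
     + dgamma * 'D_(1 : R) (fun tau => f (xi t, tau)) (gamma t)).
Proof.
move=> df dxiE dgE.
have xit : derivable xi t 1 by apply/derivable_mxP => i j; rewrite ord1; case: (dxiE j).
have gt : derivable gamma t 1 by case: dgE.
have dx : differentiable xi t by apply/derivable1_diffP.
have dg : differentiable gamma t by apply/derivable1_diffP.
have dc : differentiable (fun r => (xi r, gamma r)) t by exact: differentiable_pair.
have dfc : differentiable (fun r => f (xi r, gamma r)) t.
  exact: (differentiable_comp dc df).
have H : is_derive t (1 : R) (fun r => f (xi r, gamma r))
    ('D_(1 : R) (fun r => f (xi r, gamma r)) t).
  by exact/derivableP/diff_derivable.
apply: (is_derive_eq H).
rewrite deriveE // (diff_comp dc df) /= (diff_pair dx dg).
have [_ <-] := dgE.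
have [_ ->] := diff_snd_line df.
rewrite -(deriveE _ dx) -(deriveE _ dg) derive_mx //.
have dfst (v : 'rV[R]_n) : 'D_v (fun y => f (y, gamma t)) (xi t) = 'd f (xi t, gamma t) (v, 0).
  by have [_ ->] := diff_fst_line v df.
under eq_bigr => j _ do rewrite dfst.
(* The velocity is decomposed along the basis vectors of space and the unit vector of time. *)
have -> : (\matrix_(i < 1, j < n) 'D_(1 : R) (fun r => xi r i j) t, 'D_(1 : R) gamma t)
  = \sum_(j < n) dxi j *: (basis_vec R j, 0 : R) + 'D_(1 : R) gamma t *: (0 : 'rV[R]_n, 1 : R).
  apply: injective_projections => /=.
    rewrite scaler0 addr0 (big_morph fst (fun _ _ => erefl) erefl).
    rewrite [RHS](_ : _ = \row_j dxi j); last first.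
      by rewrite [RHS]row_sum_delta; apply: eq_bigr => j _; rewrite mxE.
    by apply/rowP => j; rewrite !mxE; case: (dxiE j).
  rewrite (big_morph snd (fun _ _ => erefl) erefl) big1 ?add0r ?[_ *: _]mulr1 //.
  by move=> j _; rewrite /= scaler0.
rewrite linearD linearZ linear_sum; congr (_ + _).
by apply: eq_bigr => j _; rewrite linearZ.
Qed.
End JointChainRule.

(** * Space derivatives of the ansatz at a fixed time *)

Section Gauge.
Variables (R : realType) (n : nat).
Implicit Types (w : 'rV[R]_n -> R -> R[i]) (g : 'rV[R]_n -> R[i]) (x : 'rV[R]_n).

Lemma complex_Re_realM (r : R) (z : R[i]) : complex.Re (r%:C%C * z) = r * complex.Re z.
Proof. by rewrite complex_ReM /= mul0r subr0. Qed.

Lemma complex_Im_realM (r : R) (z : R[i]) : complex.Im (r%:C%C * z) = r * complex.Im z.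
Proof. by rewrite complex_ImM /= mul0r addr0. Qed.

Lemma is_cderive_curve w (xi : R -> 'rV[R]_n) (gamma : R -> R) t dxi dgamma :
  cdifferentiable (fun p : 'rV[R]_n * R => w p.1 p.2) (xi t, gamma t) ->
  (forall j, is_derive t (1 : R) (fun r => xi r 0 j) (dxi j)) ->
  is_derive t (1 : R) gamma dgamma ->
  is_cderive t (1 : R) (fun r => w (xi r) (gamma r))
    (\sum_(j < n) (dxi j)%:C%C * cderive (w^~ (gamma t)) (basis_vec R j) (xi t)
     + dgamma%:C%C * dtime w (xi t) (gamma t)).
Proof.
move=> [wR wI] dxiE dgE; split.
- apply: (is_derive_eq (is_derive_curve wR dxiE dgE)).
  rewrite complex_ReD complex_Re_realM; congr (_ + _).
  rewrite (big_morph _ (@complex_ReD R) (erefl : complex.Re 0 = 0)).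
  by apply: eq_bigr => j _; rewrite complex_Re_realM.
- apply: (is_derive_eq (is_derive_curve wI dxiE dgE)).
  rewrite complex_ImD complex_Im_realM; congr (_ + _).
  rewrite (big_morph _ (@complex_ImD R) (erefl : complex.Im 0 = 0)).
  by apply: eq_bigr => j _; rewrite complex_Im_realM.
Qed.

Lemma is_derive_coord x v (k : 'I_n) :
  is_derive x v (fun y : 'rV[R]_n => y 0 k : R) (v 0 k).
Proof.
apply/is_derive1P; under eq_fun do rewrite !mxE.
apply: (is_derive_eq (is_derive_add (is_derive_mul (is_derive_id (0 : R) (1 : R))
  (is_derive_cst (v 0 k) (0 : R) (1 : R))) (is_derive_cst (x 0 k) (0 : R) (1 : R)))).
by rewrite mul1r mulr0 !addr0.
Qed.

Definition phase (al : R) (de ka : 'I_n -> R) x : R :=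
  \sum_(j < n) (al * (x 0 j) ^+ 2 + de j * x 0 j + ka j).

Definition affine (be : R) (ep : 'I_n -> R) x : 'rV[R]_n :=
  \row_(j < n) (be * x 0 j + ep j).

(** The ansatz with time frozen: the coefficients are numbers and [g] is a time slice of the
    solution. *)
Definition gauge c al be de ep ka g x : R[i] :=
  c%:C%C * expi (phase al de ka x) * g (affine be ep x).

Lemma transformE alpha beta gamma mu (delta eps kappa : 'I_n -> R -> R) w x t :
  transform alpha beta gamma mu delta eps kappa w x t =
  gauge (Num.sqrt (mu t))^-1 (alpha t) (beta t) (delta^~ t) (eps^~ t) (kappa^~ t)
    (w^~ (gamma t)) x.
Proof. by []. Qed.

Lemma is_derive_phase al de ka x j :
  is_derive x (basis_vec R j) (phase al de ka) (2 * al * x 0 j + de j).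
Proof.
have H k : is_derive x (basis_vec R j)
    (fun y : 'rV[R]_n => al * (y 0 k) ^+ 2 + de k * y 0 k + ka k)
    ((2 * al * x 0 k + de k) * (k == j)%:R).
  have dk := is_derive_coord x (basis_vec R j) k.
  have dc c := is_derive_cst (c : R) x (basis_vec R j).
  apply: (is_derive_eq (is_derive_add (is_derive_add
    (is_derive_mul (dc al) (is_derive_mul dk dk))
    (is_derive_mul (dc (de k)) dk)) (dc (ka k)))).
  by rewrite mxE eqxx /=; ring.
apply: (is_derive_eq (is_derive_bigsum H)).
rewrite (bigD1 j) //= eqxx mulr1 big1 ?addr0 // => k /negbTE ->.
by rewrite mulr0.
Qed.

Lemma affine_line be ep x j (h : R) :
  affine be ep (h *: basis_vec R j + x) = (h * be) *: basis_vec R j + affine be ep x.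
Proof. by apply/rowP => k; rewrite !mxE; ring. Qed.

(** The affine map sends a line in direction [j] to a line in the same direction, run at speed [be],
    so derivability of [g] along that line is enough. The result is again built from [gauge], which
    allows a second differentiation by the same rule. *)
Lemma is_cderive_gauge c al be de ep ka g x j :
  cderivable g (affine be ep x) (basis_vec R j) ->
  is_cderive x (basis_vec R j) (gauge c al be de ep ka g)
    ('i%C * (2 * al * x 0 j + de j)%:C%C * gauge c al be de ep ka g x
     + be%:C%C * gauge c al be de ep ka (cderive g (basis_vec R j)) x).
Proof.
move=> dg.
have dgA : is_cderive x (basis_vec R j) (fun y => g (affine be ep y))
    (be%:C%C * cderive g (basis_vec R j) (affine be ep x)).
  have [gR gI] := cderivableP dg.
  split; rewrite (complex_Re_realM, complex_Im_realM).
  - exact: (is_derive_line (affine_line be ep x j) gR).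
  - exact: (is_derive_line (affine_line be ep x j) gI).
have H := is_cderiveM (is_cderiveM (is_cderive_cst x (basis_vec R j) c%:C%C)
  (is_cderive_expi (is_derive_phase al de ka x j))) dgA.
by apply: (is_cderive_eq H); rewrite /gauge; ring.
Qed.

Lemma is_cderive2_gauge c al be de ep ka g x j :
  (forall y, cderivable g y (basis_vec R j)) ->
  (forall y, cderivable (cderive g (basis_vec R j)) y (basis_vec R j)) ->
  is_cderive x (basis_vec R j) (cderive (gauge c al be de ep ka g) (basis_vec R j))
    (((2 * al)%:C%C * 'i%C - (2 * al * x 0 j + de j)%:C%C ^+ 2)
       * gauge c al be de ep ka g x
     + 2 * be%:C%C * 'i%C * (2 * al * x 0 j + de j)%:C%C
       * gauge c al be de ep ka (cderive g (basis_vec R j)) x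
     + be%:C%C ^+ 2
       * gauge c al be de ep ka (cderive (cderive g (basis_vec R j)) (basis_vec R j)) x).
Proof.
move=> dg ddg.
(* The first derivative has to be known as a function, not only at [x], before it is differentiated
   again; this uses derivability of [g] at every point. *)
have -> : cderive (gauge c al be de ep ka g) (basis_vec R j) = fun y =>
    'i%C * (2 * al * y 0 j + de j)%:C%C * gauge c al be de ep ka g y
     + be%:C%C * gauge c al be de ep ka (cderive g (basis_vec R j)) y.
  by apply/funext => y; apply: is_cderive_val; exact: is_cderive_gauge.
have dS : is_derive x (basis_vec R j) (fun y : 'rV[R]_n => 2 * al * y 0 j + de j) (2 * al).
  apply: (is_derive_eq (is_derive_add (is_derive_mul
    (is_derive_cst (2 * al) x (basis_vec R j)) (is_derive_coord x (basis_vec R j) j))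
    (is_derive_cst (de j) x (basis_vec R j)))).
  by rewrite mxE !eqxx mulr1 mul0r add0r addr0.
have H := is_cderiveD
  (is_cderiveM (is_cderiveM (is_cderive_cst x (basis_vec R j) 'i%C) (is_cderive_real dS))
     (is_cderive_gauge c al de ka (dg (affine be ep x))))
  (is_cderiveM (is_cderive_cst x (basis_vec R j) be%:C%C)
     (is_cderive_gauge c al de ka (ddg (affine be ep x)))).
apply: (is_cderive_eq H); ring: (sqr_i R).
Qed.

End Gauge.

(** * Transport of a Schroedinger equation by the ansatz *)

Section TransformPDE.
Variables (R : realType) (n : nat).
Variables (alpha beta gamma mu : R -> R) (delta eps kappa : 'I_n -> R -> R).
Implicit Types (w : 'rV[R]_n -> R -> R[i]) (x : 'rV[R]_n).

Local Notation T := (transform alpha beta gamma mu delta eps kappa).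

(* The Riccati system for a transformation that turns solutions of
   [i w_tau = p Delta w + q |xi|^2 w + N w] into solutions of
   [i psi_t = P Delta psi + Q |x|^2 psi + gamma' N psi]. It is used with
   [(p, q, P, Q) = (1, 0, - a, b)], and with [(- a, b, 1, 0)] for the inverse
   transformation. *)
Record gauge_flow (t p q P Q dga : R) : Prop := GaugeFlow {
  _ : 0 < mu t;
  _ : dga * p = P * beta t ^+ 2;
  _ : is_derive t (1 : R) alpha (dga * q * beta t ^+ 2 + 4 * P * alpha t ^+ 2 - Q);
  _ : is_derive t (1 : R) beta (4 * P * alpha t * beta t);
  _ : is_derive t (1 : R) gamma dga;
  _ : is_derive t (1 : R) mu (- (4 * n%:R * P * alpha t * mu t));
  _ : forall j, is_derive t (1 : R) (delta j)
        (2 * dga * q * beta t * eps j t + 4 * P * alpha t * delta j t);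
  _ : forall j, is_derive t (1 : R) (eps j) (2 * P * beta t * delta j t);
  _ : forall j, is_derive t (1 : R) (kappa j)
        (dga * q * eps j t ^+ 2 + P * delta j t ^+ 2) }.

Lemma is_derive_invsqrt (t dmu : R) : 0 < mu t -> is_derive t (1 : R) mu dmu ->
  is_derive t (1 : R) (fun r => (Num.sqrt (mu r))^-1)
    (- dmu / (2 * mu t) * (Num.sqrt (mu t))^-1).
Proof.
move=> mu0 dm; have s0 : Num.sqrt (mu t) != 0 by rewrite gt_eqF // sqrtr_gt0.
have ds : is_derive t (1 : R) (fun r => Num.sqrt (mu r)) _ :=
  is_derive_comp1 (is_derive1_sqrt mu0) dm.
have H := is_derive_inv (f := fun r => Num.sqrt (mu r)) s0 ds.
apply: (is_derive_eq H).
(* Writing [mu t] as the square of its root makes the identity rational in that root. *)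
rewrite -[X in - dmu / (2 * X)](sqr_sqrtr (ltW mu0)).
by field.
Qed.

Lemma transform_cdifferentiable w x t p q P Q dga : gauge_flow t p q P Q dga ->
  cdifferentiable (fun p : 'rV[R]_n * R => w p.1 p.2)
    (affine (beta t) (eps^~ t) x, gamma t) ->
  cdifferentiable (fun p : 'rV[R]_n * R => T w p.1 p.2) (x, t).
Proof.
move=> [mu0 _ [dal _] [dbe _] [dg _] Dmu dd de dk] dw.
pose V := ('rV[R]_n * R)%type.
have tcomp (f : R -> R) : derivable f t 1 -> differentiable (fun p : V => f p.2) (x, t).
  move=> /derivable1_diffP df.
  exact: (differentiable_comp (differentiable_snd (x, t)) df).
have xcomp j : differentiable (fun p : V => p.1 0 j : R) (x, t).
  exact: (differentiable_comp (differentiable_fst (x, t)) (differentiable_coord x 0 j)).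
apply: cdifferentiableM; first apply: cdifferentiableM.
- apply: cdifferentiable_real; apply: (tcomp (fun r => (Num.sqrt (mu r))^-1)).
  by have [] := is_derive_invsqrt mu0 Dmu.
- apply: cdifferentiable_expi; apply: differentiable_bigsum => j.
  have [ddj _] := dd j; have [dkj _] := dk j.
  apply: differentiable_add (tcomp _ dkj).
  apply: differentiable_add; apply: differentiable_mul => //; try exact: tcomp.
  exact: differentiable_mul.
- apply: (cdifferentiable_comp (f := fun p : V => (affine (beta p.2) (eps^~ p.2) p.1, gamma p.2))
    (g := fun p : V => w p.1 p.2)) => //.
  apply: differentiable_pair; last exact: tcomp.
  apply: differentiable_row => j; have [dej _] := de j.
  apply: differentiable_add (tcomp _ dej).
  apply: differentiable_mul => //; exact: tcomp.
Qed.

(** Product rule for amplitude, phase factor and [w] along the moving point. The amplitude times the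
    phase factor is pulled out, since it multiplies every term of the equation. *)
Lemma is_cderive_transform_time w x t dal dbe dga dmu dde dep dka :
  0 < mu t ->
  is_derive t (1 : R) alpha dal -> is_derive t (1 : R) beta dbe ->
  is_derive t (1 : R) gamma dga -> is_derive t (1 : R) mu dmu ->
  (forall j, is_derive t (1 : R) (delta j) (dde j)) ->
  (forall j, is_derive t (1 : R) (eps j) (dep j)) ->
  (forall j, is_derive t (1 : R) (kappa j) (dka j)) ->
  cdifferentiable (fun p : 'rV[R]_n * R => w p.1 p.2)
    (affine (beta t) (eps^~ t) x, gamma t) ->
  dtime (T w) x t =
    ((Num.sqrt (mu t))^-1)%:C%C * expi (phase (alpha t) (delta^~ t) (kappa^~ t) x) *
    (((- dmu / (2 * mu t))%:C%C
       + 'i%C * (\sum_(j < n) (dal * x 0 j ^+ 2 + dde j * x 0 j + dka j))%:C%C)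
         * w (affine (beta t) (eps^~ t) x) (gamma t)
     + \sum_(j < n) (dbe * x 0 j + dep j)%:C%C
         * cderive (w^~ (gamma t)) (basis_vec R j) (affine (beta t) (eps^~ t) x)
     + dga%:C%C * dtime w (affine (beta t) (eps^~ t) x) (gamma t)).
Proof.
move=> mu0 Dal Dbe Dga Dmu Dde Dep Dka dw.
have lin (f : R -> R) (df c : R) : is_derive t (1 : R) f df ->
    is_derive t (1 : R) (fun r => f r * c) (df * c).
  move=> Df; apply: (is_derive_eq (is_derive_mul Df (is_derive_cst c t (1 : R)))).
  by rewrite mulr0 addr0.
have Dph : is_derive t (1 : R) (fun r => phase (alpha r) (delta^~ r) (kappa^~ r) x)
    (\sum_(j < n) (dal * x 0 j ^+ 2 + dde j * x 0 j + dka j)).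
  apply: is_derive_bigsum => j.
  exact: (is_derive_add (is_derive_add (lin _ _ _ Dal) (lin _ _ _ (Dde j))) (Dka j)).
have Dxi j : is_derive t (1 : R) (fun r => affine (beta r) (eps^~ r) x 0 j)
    (dbe * x 0 j + dep j).
  under eq_fun do rewrite mxE.
  exact: (is_derive_add (lin _ _ _ Dbe) (Dep j)).
have H := is_cderiveM (is_cderiveM (is_cderive_real (is_derive_invsqrt mu0 Dmu))
  (is_cderive_expi Dph)) (is_cderive_curve dw Dxi Dga).
rewrite [LHS](is_cderive_val H) rmorphM /=; ring.
Qed.

Lemma space_cderivable w y v tau :
  cdifferentiable (fun p : 'rV[R]_n * R => w p.1 p.2) (y, tau) ->
  cderivable (w^~ tau) y v.
Proof.
move=> [wR wI].
by split; [case: (diff_fst_line v wR)|case: (diff_fst_line v wI)].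
Qed.

(** The source equation is used only at the single point [xi], so the potential enters as one real
    number [N]. Regularity is required on the whole time slice because second space derivatives of
    the ansatz are taken. *)
Lemma transform_pde w x t (p q P Q N dga : R) :
  gauge_flow t p q P Q dga ->
  (forall y, cdifferentiable (fun p : 'rV[R]_n * R => w p.1 p.2) (y, gamma t)) ->
  (forall y j, cderivable (cderive (w^~ (gamma t)) (basis_vec R j)) y (basis_vec R j)) ->
  let xi := affine (beta t) (eps^~ t) x in
  'i%C * dtime w xi (gamma t) =
    p%:C%C * laplacian (w^~ (gamma t)) xi + (q * sqnorm xi)%:C%C * w xi (gamma t)
    + N%:C%C * w xi (gamma t) ->
  'i%C * dtime (T w) x t =
    P%:C%C * laplacian ((T w)^~ t) x + (Q * sqnorm x)%:C%C * T w x t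
    + (dga * N)%:C%C * T w x t.
Proof.
move=> [mu0 Hp Dal Dbe Dga Dmu Dde Dep Dka] dw ddw xi Hw.
have dw1 y j := space_cderivable (basis_vec R j) (dw y).
rewrite (is_cderive_transform_time mu0 Dal Dbe Dga Dmu Dde Dep Dka (dw _)).
have ddT j := is_cderive_val (is_cderive2_gauge (Num.sqrt (mu t))^-1 (alpha t)
  (beta t) (delta^~ t) (eps^~ t) (kappa^~ t) x (dw1^~ j) (ddw^~ j)).
rewrite [laplacian _ x](eq_bigr _ (fun j _ => ddT j)).
rewrite transformE /gauge -/xi.
set E := _%:C%C * expi _; set W := w xi (gamma t).
set W1 := fun j => cderive (w^~ (gamma t)) (basis_vec R j) xi.
set W2 := fun j => cderive (cderive (w^~ (gamma t)) (basis_vec R j)) (basis_vec R j) xi.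
set m := (X in X%:C%C + 'i%C * _).
(* The amplitude term is split evenly over the [n] coordinates, where it cancels the term in [alpha]
   of each second derivative of the phase factor. *)
have mE : m%:C%C = \sum_(j < n) (2 * P * alpha t)%:C%C.
  rewrite sumr_const card_ord -rmorphMn; congr (_%:C%C).
  by rewrite /m -mulr_natr; field; rewrite gt_eqF.
set dph := fun j : 'I_n => (dga * q * beta t ^+ 2 + 4 * P * alpha t ^+ 2 - Q) * x 0 j ^+ 2
  + (2 * dga * q * beta t * eps j t + 4 * P * alpha t * delta j t) * x 0 j
  + (dga * q * eps j t ^+ 2 + P * delta j t ^+ 2).
set dxi := fun j : 'I_n => 4 * P * alpha t * beta t * x 0 j + 2 * P * beta t * delta j t.
set S := (X in m%:C%C + 'i%C * X%:C%C); have SE : S = \sum_(j < n) dph j by [].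
set X := (X in _ + X + dga%:C%C * _); have XE : X = \sum_(j < n) (dxi j)%:C%C * W1 j by [].
clearbody S X.
(* Everything is gathered into one sum over the coordinates. The left side reaches this form through
   the source equation [Hw]; the right side agrees with it summand by summand, modulo the square of
   the imaginary unit being -1. *)
transitivity (E * (\sum_(j < n) (('i%C * (2 * P * alpha t)%:C%C - (dph j)%:C%C) * W
    + 'i%C * ((dxi j)%:C%C * W1 j) + (dga * p)%:C%C * W2 j
    + (dga * q)%:C%C * (xi 0 j ^+ 2)%:C%C * W) + (dga * N)%:C%C * W)).
  rewrite !big_split /= -!mulr_suml -!mulr_sumr sumrB -mulr_sumr -mE -!rmorph_sum -SE -XE.
  transitivity (E * (('i%C * m%:C%C - S%:C%C) * W + 'i%C * X
    + dga%:C%C * ('i%C * dtime w xi (gamma t)))); first by ring: (sqr_i R).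
  rewrite Hw /laplacian -/W !rmorphM /= /sqnorm; ring.
rewrite mulrDr; congr (_ + _); last by ring.
rewrite /sqnorm [(Q * _)%:C%C]rmorphM rmorph_sum /= !mulr_sumr mulr_suml -big_split /=.
apply: eq_bigr => j _; rewrite /dph /dxi !mxE Hp -/(W1 j) -/(W2 j).
ring: (sqr_i R).
Qed.


(** A linear equation with a given real potential [N]. A coupled nonlinear system is a pair of
    these, with [N] computed from its two solutions. *)
Definition schrodinger (J : set R) (p q : R -> R) (N : 'rV[R]_n -> R -> R) w : Prop :=
  classical J w /\
  forall x t, J t -> 'i%C * dtime w x t =
    (p t)%:C%C * laplacian (w^~ t) x + (q t * sqnorm x)%:C%C * w x t
    + (N x t)%:C%C * w x t.

Lemma transform_schrodinger (J J' : set R) (p q P Q dga : R -> R) N w :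
  (forall t, J t -> J' (gamma t)) ->
  (forall t, J t -> gauge_flow t (p (gamma t)) (q (gamma t)) (P t) (Q t) (dga t)) ->
  schrodinger J' p q N w ->
  schrodinger J P Q
    (fun x t => dga t * N (affine (beta t) (eps^~ t) x) (gamma t)) (T w).
Proof.
move=> JJ' flow [wcl weq].
have dw t : J t -> forall y, cdifferentiable (fun p : 'rV[R]_n * R => w p.1 p.2) (y, gamma t).
  by move=> Jt y; case: (wcl y _ (JJ' _ Jt)).
have ddw t : J t -> forall y j,
    cderivable (cderive (w^~ (gamma t)) (basis_vec R j)) y (basis_vec R j).
  by move=> Jt y j; have [_] := wcl y _ (JJ' _ Jt); apply.
split=> [x t Jt|x t Jt]; last first.
  exact: (transform_pde (flow _ Jt) (dw _ Jt) (ddw _ Jt) (weq _ _ (JJ' _ Jt))).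
split; first exact: (transform_cdifferentiable (flow _ Jt) (dw _ Jt _)).
move=> j; have dw1 y := space_cderivable (basis_vec R j) (dw _ Jt y).
exact: (is_cderive_ex (is_cderive2_gauge (Num.sqrt (mu t))^-1 (alpha t) (beta t)
  (delta^~ t) (eps^~ t) (kappa^~ t) x dw1 (ddw _ Jt ^~ j))).
Qed.

End TransformPDE.

(** * The nonlinearity under the ansatz *)

Section Coupling.
Variable R : realType.

Lemma normc_expi (theta : R) : Normc.normc (expi theta) = 1.
Proof. by rewrite /Normc.normc /expi cos2Dsin2 sqrtr1. Qed.

Lemma normc_real (r : R) : 0 <= r -> Normc.normc r%:C%C = r.
Proof. by move=> r0; rewrite /Normc.normc /= expr0n addr0 sqrtr_sqr ger0_norm. Qed.

Lemma normc_ge0 (z : R[i]) : 0 <= Normc.normc z.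
Proof. by case: z => x y; rewrite /Normc.normc sqrtr_ge0. Qed.

Lemma expiD (x y : R) : expi (x + y) = expi x * expi y.
Proof. by rewrite /expi cosD sinD [sin x * _ + _]addrC. Qed.

Lemma expi0 : expi (0 : R) = 1.
Proof. by rewrite /expi cos0 sin0. Qed.

(** The phase factor has modulus 1 and the amplitude contributes the power [-s] of [mu t], which the
    factor in front compensates. *)
Lemma transform_coupling n (alpha beta gamma mu : R -> R) (delta eps kappa : 'I_n -> R -> R)
    (s : R) (u v : 'rV[R]_n -> R -> R[i]) x t :
  0 < mu t ->
  mu t `^ s * coupling s (transform alpha beta gamma mu delta eps kappa v x t)
                         (transform alpha beta gamma mu delta eps kappa u x t) =
  coupling s (v (affine (beta t) (eps^~ t) x) (gamma t))
             (u (affine (beta t) (eps^~ t) x) (gamma t)).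
Proof.
move=> mu0.
have H (w : 'rV[R]_n -> R -> R[i]) : mu t `^ s *
    Normc.normc (transform alpha beta gamma mu delta eps kappa w x t) `^ (2 * s) =
    Normc.normc (w (affine (beta t) (eps^~ t) x) (gamma t)) `^ (2 * s).
  have s0 : 0 < Num.sqrt (mu t) by rewrite sqrtr_gt0.
  rewrite /transform -/(affine _ _ _) !Normc.normcM normc_expi mulr1 normc_real ?invr_ge0 ?ltW //.
  (* The power [s] of [mu t] is the power [2 * s] of its root, so both factors merge under one
     exponent. *)
  rewrite -[X in X `^ s](sqr_sqrtr (ltW mu0)) -powR_mulrn ?ltW // -powRrM.
  rewrite -powRM ?mulr_ge0 ?invr_ge0 ?normc_ge0 ?(ltW s0) //.
  by rewrite mulVKf // gt_eqF.
by rewrite /coupling mulrDr !H.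
Qed.

End Coupling.

(** * Linking the Riccati equation to the second-order equation for [mu] *)

(** The substitution is assumed on a neighbourhood of [t], since the derivative of [alpha] at [t] is
    computed from it. *)
Lemma riccati_substitution (R : realType) (n : nat) (a b alpha mu : R -> R) (t : R) :
  (0 < n)%N -> a t != 0 -> 0 < mu t ->
  derivable a t 1 -> derivable mu t 1 -> derivable (derive1 mu) t 1 ->
  (\near t, alpha t = derive1 mu t / (4 * n%:R * a t * mu t)) ->
  riccati_eq a b alpha t <->
  derive1 (derive1 mu) t - derive1 a t / a t * derive1 mu t + 4 * n%:R * a t * b t * mu t
    + (1 - n%:R) / n%:R * (derive1 mu t ^+ 2 / mu t) = 0.
Proof.
move=> n0 a0 mu0 da dmu ddmu alphaE.
have nn0 : n%:R != 0 :> R by rewrite pnatr_eq0 -lt0n.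
have mun0 : mu t != 0 by rewrite gt_eqF.
pose D r := 4 * n%:R * a r * mu r.
have D0 : D t != 0 by rewrite !mulf_neq0 // pnatr_eq0.
have cst (c : R) := is_derive_cst c t (1 : R).
have Dn : is_derive t (1 : R) D (4 * n%:R * ('D_1 a t * mu t + a t * 'D_1 mu t)).
  apply: (is_derive_eq (is_derive_mul (is_derive_mul (cst (4 * n%:R)) (derivableP da))
    (derivableP dmu))).
  by rewrite /=; ring.
have dal := near_eq_derive (1 : R) alphaE.
have [_ dq] := is_derive_mul (derivableP ddmu) (is_derive_inv D0 Dn).
rewrite /riccati_eq !derive1E.
rewrite dal dq (nbhs_singleton alphaE) /D derive1E.
set m1 := 'D_1 mu t; set m2 := 'D_1 (derive1 mu) t; set a1 := 'D_1 a t.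
(* The second-order expression is the Riccati expression multiplied by the nonzero denominator [D t]
   of the substitution. *)
have E : m2 - a1 / a t * m1 + 4 * n%:R * a t * b t * mu t + (1 - n%:R) / n%:R * (m1 ^+ 2 / mu t)
  = D t * (m2 / D t + m1 * (- (D t) ^- 2 * (4 * n%:R * (a1 * mu t + a t * m1))) + b t
           + 4 * a t * (m1 / D t) ^+ 2).
  by rewrite /D; field; rewrite mun0 nn0 a0.
by rewrite E; split => [->|/eqP]; [rewrite mulr0|rewrite mulf_eq0 (negbTE D0) => /eqP].
Qed.

(** * The inverse transformation and injectivity of the time change *)

Section Inverse.
Variables (R : realType) (n : nat).
Variables (alpha beta gamma mu g : R -> R) (delta eps kappa : 'I_n -> R -> R).

(** These six coefficients come from solving [xi_j = beta x_j + eps_j] for [x_j], substituting into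
    the negated phase and sorting by powers of [xi_j]. The function [g] stands for the inverse of
    [gamma]. *)
Definition inv_alpha r := - (alpha (g r) / beta (g r) / beta (g r)).
Definition inv_beta r := (beta (g r))^-1.
Definition inv_mu r := (mu (g r))^-1.
Definition inv_eps (j : 'I_n) r := - (eps j (g r) / beta (g r)).
Definition inv_delta (j : 'I_n) r :=
  (2 * alpha (g r) * eps j (g r) / beta (g r) - delta j (g r)) / beta (g r).
Definition inv_kappa (j : 'I_n) r :=
  (delta j (g r) - alpha (g r) * eps j (g r) / beta (g r)) * (eps j (g r) / beta (g r))
  - kappa j (g r).

Local Notation T := (transform alpha beta gamma mu delta eps kappa).
Local Notation T' :=
  (transform inv_alpha inv_beta g inv_mu inv_delta inv_eps inv_kappa).

(** The affine maps compose to the identity, the phases are opposite and the amplitudes are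
    reciprocal. This order of composition is the one that recovers a given solution from its
    constructed preimage. *)
Lemma transform_inverse (w : 'rV[R]_n -> R -> R[i]) x t :
  0 < mu t -> beta t != 0 -> g (gamma t) = t -> T (T' w) x t = w x t.
Proof.
move=> mu0 b0 gt.
rewrite transformE /gauge transformE /gauge /inv_mu /inv_beta gt -/(affine _ _ _).
have -> : affine (beta t)^-1 (inv_eps^~ (gamma t)) (affine (beta t) (eps^~ t) x) = x.
  by apply/rowP => j; rewrite !mxE /inv_eps gt; field.
have ph : phase (inv_alpha (gamma t)) (inv_delta^~ (gamma t)) (inv_kappa^~ (gamma t))
    (affine (beta t) (eps^~ t) x) = - phase (alpha t) (delta^~ t) (kappa^~ t) x.
  rewrite /phase -sumrN; apply: eq_bigr => j _; rewrite !mxE.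
  by rewrite /inv_alpha /inv_delta /inv_kappa gt; field.
have s0 : Num.sqrt (mu t) != 0 by rewrite gt_eqF // sqrtr_gt0.
rewrite ph sqrtrV ?ltW // invrK.
rewrite mulrA mulrACA -rmorphM /= mulVf // -expiD subrr expi0.
by rewrite !mul1r.
Qed.

(** Composition with [g] multiplies each derivative by the reciprocal of [- a * beta t ^+ 2], the
    derivative of [gamma]; each remaining claim is a rational identity. *)
Lemma inverse_flow (t a b : R) : a != 0 -> beta t != 0 -> g (gamma t) = t ->
  gauge_flow alpha beta gamma mu delta eps kappa t 1 0 (- a) b (- a * beta t ^+ 2) ->
  is_derive (gamma t) (1 : R) g (- a * beta t ^+ 2)^-1 ->
  gauge_flow inv_alpha inv_beta g inv_mu inv_delta inv_eps inv_kappa (gamma t)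
    (- a) b 1 0 (- a * beta t ^+ 2)^-1.
Proof.
move=> a0 b0 gt [mu0 _ Dal Dbe Dga Dmu Dde Dep Dka] Dg.
have m0 : mu t != 0 by rewrite gt_eqF.
have Dc (f : R -> R) df : is_derive t (1 : R) f df ->
    is_derive (gamma t) (1 : R) (fun r => f (g r)) (df * (- a * beta t ^+ 2)^-1).
  by move=> Df; apply: is_derive_comp1 Dg; rewrite gt.
have cst (c : R) := is_derive_cst c t (1 : R).
have Dib := is_derive_inv b0 Dbe.
split; rewrite /inv_mu /inv_alpha /inv_beta /inv_eps /inv_delta /inv_kappa ?gt.
- by rewrite invr_gt0.
- by rewrite /=; field; rewrite a0 b0.
(* The outer sign is treated as a constant factor -1, so the product rule covers it. *)
- have H := is_derive_mul (cst (-1)) (is_derive_mul (is_derive_mul Dal Dib) Dib).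
  under eq_fun do rewrite -mulN1r.
  by apply: (is_derive_eq (Dc _ _ H)); rewrite /=; field; rewrite a0 b0.
- by apply: (is_derive_eq (Dc _ _ Dib)); rewrite /=; field; rewrite a0 b0.
- exact: Dg.
- by apply: (is_derive_eq (Dc _ _ (is_derive_inv m0 Dmu))); rewrite /=; field; rewrite a0 b0 m0.
- move=> j.
  have H := is_derive_mul (is_derive_sub (is_derive_mul (is_derive_mul (is_derive_mul
    (cst 2) Dal) (Dep j)) Dib) (Dde j)) Dib.
  by apply: (is_derive_eq (Dc _ _ H)); rewrite /=; field; rewrite a0 b0.
- move=> j; under eq_fun do rewrite -mulN1r.
  have H := is_derive_mul (cst (-1)) (is_derive_mul (Dep j) Dib).
  by apply: (is_derive_eq (Dc _ _ H)); rewrite /=; field; rewrite a0 b0.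
- move=> j.
  have H := is_derive_sub (is_derive_mul (is_derive_sub (Dde j) (is_derive_mul
    (is_derive_mul Dal (Dep j)) Dib)) (is_derive_mul (Dep j) Dib)) (Dka j).
  by apply: (is_derive_eq (Dc _ _ H)); rewrite /=; field; rewrite a0 b0.
Qed.

End Inverse.

(** Two points with equal values would give, by Rolle, a zero of the derivative between them, hence
    inside the interval [J]. *)
Lemma derive1_neq0_injective (R : realType) (J : set R) (f : R -> R) :
  is_interval J -> (forall t, J t -> derivable f t 1) ->
  (forall t, J t -> derive1 f t != 0) -> {in J &, injective f}.
Proof.
move=> Jitv df df0.
have lt_neq t1 t2 : J t1 -> J t2 -> t1 < t2 -> f t1 != f t2.
  move=> J1 J2 lt12; apply/eqP => f12.
  have sub t : t1 <= t <= t2 -> J t by apply: Jitv.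
  have dfi : forall t, t \in `]t1, t2[%R -> derivable f t 1.
    by move=> t; rewrite in_itv /= => /andP[/ltW ? /ltW ?]; apply/df/sub/andP.
  have cf : {within `[t1, t2], continuous f}.
    by apply: derivable_within_continuous => t; rewrite in_itv /= => ?; exact/df/sub.
  have [c + [_ fc]] := Rolle lt12 dfi cf f12.
  rewrite in_itv /= => /andP[/ltW c1 /ltW c2].
  have /df0 : J c by apply: sub; rewrite c1 c2.
  by rewrite derive1E fc eqxx.
move=> t1 t2; rewrite !inE => J1 J2 f12.
have [/lt_neq|/lt_neq|//] := ltgtP t1 t2.
- by move=> /(_ J1 J2); rewrite f12 eqxx.
- by move=> /(_ J2 J1); rewrite f12 eqxx.
Qed.

(** * Reading the coupled systems and the Riccati system in the general setting *)

Section Systems.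
Variables (R : realType) (n : nat).
Implicit Types (u v psi phi : 'rV[R]_n -> R -> R[i]).

Lemma standard_cnlsP lambda s J u v :
  standard_cnls lambda s J u v <->
  schrodinger J (cst 1) (cst 0) (fun x t => - (lambda * coupling s (v x t) (u x t))) u /\
  schrodinger J (cst 1) (cst 0) (fun x t => - (lambda * coupling s (v x t) (u x t))) v.
Proof.
split=> [[clu clv equ eqv]|[[clu equ] [clv eqv]]].
- by split; split=> // x t Jt; rewrite ?equ ?eqv //; rewrite /cst mul0r rmorphN /=; ring.
- by split=> // x t Jt; rewrite ?equ ?eqv //; rewrite /cst mul0r rmorphN /=; ring.
Qed.

Lemma nonautonomous_cnlsP (a b beta mu : R -> R) lambda s J psi phi :
  let N x t := lambda * a t * beta t ^+ 2 * mu t `^ s * coupling s (phi x t) (psi x t) in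
  nonautonomous_cnls a b beta mu lambda s J psi phi <->
  schrodinger J (fun t => - a t) b N psi /\ schrodinger J (fun t => - a t) b N phi.
Proof.
move=> N; split=> [[clu clv equ eqv]|[[clu equ] [clv eqv]]].
- by split; split=> // x t Jt; rewrite ?equ ?eqv // rmorphN.
- by split=> // x t Jt; rewrite ?equ ?eqv // rmorphN.
Qed.

Lemma schrodinger_ext J (p q : R -> R) N N' u :
  (forall x t, J t -> N x t = N' x t) -> schrodinger J p q N u -> schrodinger J p q N' u.
Proof. by move=> NE [cl eq]; split=> // x t Jt; rewrite eq // NE. Qed.

(** Each Riccati equation is solved for its derivative; the equation for [mu] is the substitution
    for [alpha] solved for the derivative of [mu]. *)
Lemma riccati_flow (a b alpha beta gamma mu : R -> R) (delta eps kappa : 'I_n -> R -> R) J t :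
  (0 < n)%N -> J t -> a t != 0 -> 0 < mu t -> derivable mu t 1 ->
  alpha t = derive1 mu t / (4 * n%:R * a t * mu t) ->
  riccati_system a b alpha beta gamma delta eps kappa J ->
  gauge_flow alpha beta gamma mu delta eps kappa t 1 0 (- a t) (b t) (- a t * beta t ^+ 2).
Proof.
move=> n0 Jt a0 mu0 dmu alphaE /(_ t Jt) [].
rewrite /riccati_eq !derive1E => -[dal eal] [dbe ebe] [dga ega] dj.
have nn0 : n%:R != 0 :> R by rewrite pnatr_eq0 -lt0n.
have Dv (f : R -> R) c : derivable f t 1 -> 'D_(1 : R) f t = c -> is_derive t (1 : R) f c.
  by move=> df <-; exact: derivableP.
have eq0 (x y z : R) : x + y = 0 -> - y = z -> x = z.
  by move=> /eqP; rewrite addr_eq0 => /eqP -> .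
split=> [||||||j|j|j].
- exact: mu0.
- by rewrite mulr1.
- by apply: Dv dal _; rewrite -addrA in eal; apply: (eq0 _ _ _ eal); ring.
- by apply: Dv dbe _; apply: (eq0 _ _ _ ebe); ring.
- by apply: Dv dga _; apply: (eq0 _ _ _ ega); ring.
- apply: Dv dmu _; rewrite alphaE derive1E; field.
  by rewrite a0 nn0 gt_eqF.
- have [[dd ed] _ _] := dj j; rewrite derive1E in ed.
  by apply: Dv dd _; apply: (eq0 _ _ _ ed); ring.
- have [_ [de ee] _] := dj j; rewrite derive1E in ee.
  by apply: Dv de _; apply: (eq0 _ _ _ ee); ring.
- have [_ _ [dk ek]] := dj j; rewrite derive1E in ek.
  by apply: Dv dk _; apply: (eq0 _ _ _ ek); ring.
Qed.

End Systems.

(** * Assembly of the forward direction, the converse and the Riccati substitution *)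

Unset Implicit Arguments.

Theorem theorem3 (R : realType) (n : nat) (n_gt0 : (0 < n)%N)
    (J : set R) (J_open : open J) (J_itv : is_interval J)
    (a b alpha beta gamma mu : R -> R) (delta eps kappa : 'I_n -> R -> R)
    (lambda s : R) (s_gt0 : 0 < s)
    (a_neq0 : forall t, J t -> a t != 0)
    (a_derivable : forall t, J t -> derivable a t 1)
    (mu_gt0 : forall t, J t -> 0 < mu t)
    (mu_derivable : forall t, J t -> derivable mu t 1)
    (dmu_derivable : forall t, J t -> derivable (derive1 mu) t 1)
    (alpha_mu : forall t, J t ->
       alpha t = derive1 mu t / (4 * n%:R * a t * mu t)) :
  (riccati_system a b alpha beta gamma delta eps kappa J ->
     (forall u v : 'rV[R]_n -> R -> R[i],
        standard_cnls lambda s (gamma @` J) u v ->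
        nonautonomous_cnls a b beta mu lambda s J
          (transform alpha beta gamma mu delta eps kappa u)
          (transform alpha beta gamma mu delta eps kappa v)) /\
     ((forall t, J t -> beta t != 0) ->
      forall psi phi : 'rV[R]_n -> R -> R[i],
        nonautonomous_cnls a b beta mu lambda s J psi phi ->
        exists u v : 'rV[R]_n -> R -> R[i],
          [/\ standard_cnls lambda s (gamma @` J) u v,
              forall x t, J t ->
                psi x t = transform alpha beta gamma mu delta eps kappa u x t
            & forall x t, J t ->
                phi x t = transform alpha beta gamma mu delta eps kappa v x t]))
  /\
  (forall t, J t ->
     riccati_eq a b alpha t <->
     derive1 (derive1 mu) t - derive1 a t / a t * derive1 mu t + 4 * n%:R * a t * b t * mu t
       + (1 - n%:R) / n%:R * (derive1 mu t ^+ 2 / mu t) = 0).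
Proof.
split=> [ric|t Jt]; last first.
  apply: riccati_substitution; rewrite ?a_neq0 ?mu_gt0 //.
  - exact: a_derivable.
  - exact: mu_derivable.
  - exact: dmu_derivable.
  (* Openness of [J] turns the pointwise substitution into one valid near [t]. *)
  - by near=> r; apply: alpha_mu; near: r; exact: open_nbhs_nbhs.
have flow t (Jt : J t) := riccati_flow n_gt0 Jt (a_neq0 t Jt) (mu_gt0 t Jt)
  (mu_derivable t Jt) (alpha_mu t Jt) ric.
split=> [u v /standard_cnlsP[clu clv]|b0 psi phi].
  (* The transported potential is the derivative of [gamma] times the standard one: the two signs
     cancel and the power of [mu] comes from the moduli. *)
  have NE x t : J t -> - a t * beta t ^+ 2 * - (lambda * coupling s
        (v (affine (beta t) (eps^~ t) x) (gamma t)) (u (affine (beta t) (eps^~ t) x) (gamma t))) =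
      lambda * a t * beta t ^+ 2 * mu t `^ s * coupling s
        (transform alpha beta gamma mu delta eps kappa v x t)
        (transform alpha beta gamma mu delta eps kappa u x t).
    move=> Jt; rewrite -[RHS]mulrA transform_coupling ?mu_gt0 //; ring.
  apply/nonautonomous_cnlsP; split; apply: (schrodinger_ext NE).
  - exact: (transform_schrodinger (@imageP _ _ gamma J) flow clu).
  - exact: (transform_schrodinger (@imageP _ _ gamma J) flow clv).
have dgE t (Jt : J t) : is_derive t (1 : R) gamma (- a t * beta t ^+ 2).
  by case: (flow t Jt).
have dg0 t (Jt : J t) : - a t * beta t ^+ 2 != 0.
  by rewrite mulf_neq0 ?oppr_eq0 ?expf_neq0 ?a_neq0 ?b0.
have dga t (Jt : J t) : derivable gamma t 1 by case: (dgE t Jt).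
have ginj : {in J &, injective gamma}.
  apply: derive1_neq0_injective => // t Jt.
  by rewrite derive1E; have [_ ->] := dgE t Jt; exact: dg0.
(* A preimage under [gamma] in [J] is chosen, with default value 0 off the image; injectivity makes
   it a left inverse on [J]. *)
pose g tau := xget 0 [set t | J t /\ gamma t = tau].
have gK t : J t -> g (gamma t) = t.
  move=> Jt; have [Jg Eg] : J (g (gamma t)) /\ gamma (g (gamma t)) = gamma t.
    by apply: (@xgetPex _ 0 [set r | J r /\ gamma r = gamma t]); exists t.
  by apply: ginj; rewrite ?inE.
(* Since [J] is open, [g] inverts [gamma] and [gamma] is continuous on a whole neighbourhood of [t],
   as the rule for inverse functions needs. *)
have Dg t (Jt : J t) : is_derive (gamma t) (1 : R) g (- a t * beta t ^+ 2)^-1.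
  have nJ : \near t, J t by exact: open_nbhs_nbhs.
  apply: is_derive_inverse (dgE t Jt) (dg0 t Jt).
  - by near=> r; apply: gK; near: r.
  - near=> r; apply: differentiable_continuous; apply/derivable1_diffP/dga.
    by near: r.
have gJ tau : (gamma @` J) tau -> J (g tau) by move=> [t Jt <-]; rewrite gK.
have iflow tau : (gamma @` J) tau -> gauge_flow
    (inv_alpha alpha beta g) (inv_beta beta g) g (inv_mu mu g) (inv_delta alpha beta g delta eps)
    (inv_eps beta g eps) (inv_kappa alpha beta g delta eps kappa) tau
    (- a (g tau)) (b (g tau)) 1 0 (- a (g tau) * beta (g tau) ^+ 2)^-1.
  move=> [t Jt <-]; rewrite gK //.
  by apply: inverse_flow; [exact: a_neq0|exact: b0|exact: gK|exact: flow|exact: Dg].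
move=> /nonautonomous_cnlsP[clpsi clphi].
pose T' := transform (inv_alpha alpha beta g) (inv_beta beta g) g (inv_mu mu g)
  (inv_delta alpha beta g delta eps) (inv_eps beta g eps) (inv_kappa alpha beta g delta eps kappa).
exists (T' psi), (T' phi); split=> [|x t Jt|x t Jt]; last 2 first.
- by rewrite transform_inverse ?mu_gt0 ?b0 ?gK.
- by rewrite transform_inverse ?mu_gt0 ?b0 ?gK.
(* Here the reciprocal derivative of [gamma] removes [a] and the square of [beta] and leaves a minus
   sign, while the powers of [mu] and [inv_mu] multiply to 1. *)
have NE xi tau : (gamma @` J) tau ->
    let x := affine (inv_beta beta g tau) ((inv_eps beta g eps)^~ tau) xi in
    (- a (g tau) * beta (g tau) ^+ 2)^-1 * (lambda * a (g tau) * beta (g tau) ^+ 2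
       * mu (g tau) `^ s * coupling s (phi x (g tau)) (psi x (g tau))) =
    - (lambda * coupling s (T' phi xi tau) (T' psi xi tau)).
  move=> gtau /=; have Jg := gJ _ gtau.
  have imu0 : 0 < inv_mu mu g tau by rewrite invr_gt0 mu_gt0.
  rewrite -(@transform_coupling R n (inv_alpha alpha beta g) (inv_beta beta g) g (inv_mu mu g)
    (inv_delta alpha beta g delta eps) (inv_eps beta g eps)
    (inv_kappa alpha beta g delta eps kappa) s psi phi xi tau imu0).
  have mus : mu (g tau) `^ s * inv_mu mu g tau `^ s = 1.
    by rewrite -powRM ?ltW ?mu_gt0 // divff ?powR1 // gt_eqF ?mu_gt0.
  have an0 := a_neq0 _ Jg; have bn0 := b0 _ Jg.
  rewrite -/T'.
  transitivity (- lambda * (mu (g tau) `^ s * inv_mu mu g tau `^ s)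
    * coupling s (T' phi xi tau) (T' psi xi tau)); last by rewrite mus; ring.
  by field; rewrite an0 bn0.
apply/standard_cnlsP; split; apply: (schrodinger_ext NE).
- exact: (transform_schrodinger gJ iflow clpsi).
- exact: (transform_schrodinger gJ iflow clphi).
Unshelve. all: by end_near. Qed.
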